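(* Let $P\subset\mathbb{R}^N$ be a polytope with vertex set $\{v_1,\dots,v_M\}$, let $v(x)$ denote a vertex of $P$ closest to $x$ in Euclidean norm (with some fixed tie-breaking rule), and for $\gamma\in P$ let $\phi_\gamma(x)=x+(\gamma-v(x))$. Then for every compact $K\subset\mathbb{R}^N$ there exists a bounded convex set $Q\supset K$ with $\phi_\gamma(Q)\subset Q$ for all $\gamma\in P$, which moreover is globally absorbing in the following sense: for every compact subset $P_0$ of the interior of $P$ and every compact $X\subset\mathbb{R}^N$ there exists $n_0$ (depending on $P_0$ and $X$) such that for all $n>n_0$ and all $\gamma_1,\dots,\gamma_n\in P_0$, $$\phi_{\gamma_1}\circ\cdots\circ\phi_{\gamma_n}(X)\subset Q.$$ *)

(* Defs.v *)
From HB Require Import structures.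
From mathcomp Require Import all_boot all_order all_algebra.
From mathcomp Require Import all_classical all_reals all_analysis.
Set Implicit Arguments. Unset Strict Implicit. Unset Printing Implicit Defensive.
Import Order.TTheory GRing.Theory Num.Theory.
Import numFieldNormedType.Exports.
Local Open Scope classical_set_scope.
Local Open Scope ring_scope.

Definition dist2 {R : realType} {N : nat} (x y : 'rV[R]_N) : R :=
  \sum_(i < N) (x ord0 i - y ord0 i) ^+ 2.

Definition polytope {R : realType} {N M : nat} (v : 'I_M -> 'rV[R]_N)
  : set 'rV[R]_N :=
  [set x | exists lam : 'I_M -> R,
      (forall i, 0 <= lam i) /\ \sum_(i < M) lam i = 1 /\
      x = \sum_(i < M) lam i *: v i].

Definition extreme_point {R : realType} {N : nat} (A : set 'rV[R]_N)
  (x : 'rV[R]_N) : Prop :=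
  A x /\ forall y z t, A y -> A z -> 0 < t < 1 ->
    x = (1 - t) *: y + t *: z -> y = x /\ z = x.

Definition convex_set_rV {R : realType} {N : nat} (Q : set 'rV[R]_N) : Prop :=
  forall x y t, Q x -> Q y -> 0 <= t <= 1 -> Q ((1 - t) *: x + t *: y).

Definition nearest_selection {R : realType} {N M : nat}
  (v : 'I_M -> 'rV[R]_N) (sel : 'rV[R]_N -> 'I_M) : Prop :=
  forall x j, dist2 x (v (sel x)) <= dist2 x (v j).

Definition phi {R : realType} {N M : nat} (v : 'I_M -> 'rV[R]_N)
  (sel : 'rV[R]_N -> 'I_M) (g x : 'rV[R]_N) : 'rV[R]_N :=
  x + (g - v (sel x)).

Definition phi_comp {R : realType} {N M : nat} (v : 'I_M -> 'rV[R]_N)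
  (sel : 'rV[R]_N -> 'I_M) (gs : seq 'rV[R]_N) (x : 'rV[R]_N) : 'rV[R]_N :=
  foldr (fun g y => phi v sel g y) x gs.

(* Main.v *)
Require Import Defs.
From HB Require Import structures.
From mathcomp Require Import all_boot all_order all_algebra.
From mathcomp Require Import all_classical all_reals all_analysis.
From mathcomp Require Import ring lra.
Set Implicit Arguments.
Unset Strict Implicit.
Unset Printing Implicit Defensive.
Import Order.TTheory GRing.Theory Num.Theory.
Import numFieldNormedType.Exports.
Local Open Scope classical_set_scope.
Local Open Scope ring_scope.

(** On the Voronoi cell of [v i] one has [<x, v j - v i> <= c] for all [j], so
    it suffices to build, for a finite family [w] and a constant [c], arbitrarily
    large bounded convex sets that contain [x + w a] as soon as they contain [x]
    and [<x, w a> <= c]. For a subfamily [s] let [p_s] be the orthogonal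
    projection along the span of [s]. Then
      [Q_r = {x | |p_s x|^2 <= r^2 - d_(size s) (r + 1) for all s}]
    works for suitable [0 = d_0 < d_1 < ...] and all large [r]: translation by
    [w a] does not change [p_s x] when [p_s (w a) = 0], and otherwise
    [|p_s (x + w a)|] can only exceed its bound when [<p_s x, w a>] is
    [O(sqrt r)], in which case the constraint for [a :: s] prevents it.

    If [g] has distance [> d] to the boundary of [P], then [phi_g x + B_d] is
    contained in [Q_r] whenever [x] is in [Q_r], so [phi_g x] lies in
    [Q_(r - eps)] with [eps] uniform for bounded [r]; hence orbits descend through
    the family [Q_r] until they reach a prescribed member. *)

(** * Euclidean scalar product *)

Definition dot {R : realFieldType} {N : nat} (x y : 'rV[R]_N) : R :=
  \sum_(i < N) x ord0 i * y ord0 i.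

Section Dot.
Context {R : realFieldType} {N : nat}.
Implicit Types x y z : 'rV[R]_N.

Lemma dotC x y : dot x y = dot y x.
Proof. by apply: eq_bigr => i _; rewrite mulrC. Qed.

Lemma dotDl x y z : dot (x + y) z = dot x z + dot y z.
Proof. by rewrite -big_split; apply: eq_bigr => i _; rewrite mxE mulrDl. Qed.

Lemma dotZl k x y : dot (k *: x) y = k * dot x y.
Proof. by rewrite mulr_sumr; apply: eq_bigr => i _; rewrite mxE mulrA. Qed.

Lemma dotDr x y z : dot x (y + z) = dot x y + dot x z.
Proof. by rewrite dotC dotDl !(dotC x). Qed.

Lemma dotZr k x y : dot x (k *: y) = k * dot x y.
Proof. by rewrite dotC dotZl dotC. Qed.

Lemma dotNl x y : dot (- x) y = - dot x y.
Proof. by rewrite -scaleN1r dotZl mulN1r. Qed.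

Lemma dotNr x y : dot x (- y) = - dot x y.
Proof. by rewrite dotC dotNl dotC. Qed.

Lemma dot0l x : dot 0 x = 0.
Proof. by rewrite -(scale0r x) dotZl mul0r. Qed.

Lemma dot_sumr (I : finType) x (f : I -> 'rV[R]_N) :
  dot x (\sum_i f i) = \sum_i dot x (f i).
Proof.
apply: (big_morph (dot x)) => [y z|]; first exact: dotDr.
by rewrite dotC dot0l.
Qed.

Definition dotE := (dotDl, dotDr, dotZl, dotZr, dotNl, dotNr).

Lemma dot_ge0 x : 0 <= dot x x.
Proof. by apply: sumr_ge0 => i _; rewrite -expr2 sqr_ge0. Qed.

Lemma sqr_coord_le_dot x i : x ord0 i ^+ 2 <= dot x x.
Proof.
rewrite /dot (bigD1 i) //= -expr2 lerDl.
by apply: sumr_ge0 => j _; rewrite -expr2 sqr_ge0.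
Qed.

Lemma dot_eq0 x : (dot x x == 0) = (x == 0).
Proof.
apply/idP/eqP => [/eqP d0|->]; last by rewrite dot0l.
apply/rowP => i; rewrite mxE; apply/eqP; rewrite -sqrf_eq0 eq_le sqr_ge0.
by rewrite -d0 sqr_coord_le_dot.
Qed.

Lemma dot_CauchySchwarz x y : dot x y ^+ 2 <= dot x x * dot y y.
Proof.
have [->|y0] := eqVneq y 0; first by rewrite !(dotC _ 0) !dot0l expr0n mulr0.
have yy : 0 < dot y y by rewrite lt_def dot_eq0 y0 dot_ge0.
have := dot_ge0 (dot y y *: x - dot x y *: y).
rewrite !dotE (dotC y x) => H.
rewrite -subr_ge0 -(pmulr_rge0 _ yy).
by apply: le_trans H _; rewrite le_eqVlt; apply/orP; left; apply/eqP; ring.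
Qed.

(* The difference of the two sides is the variance of [u] under [lam]. *)
Lemma dot_Jensen (I : finType) (lam : I -> R) (u : I -> 'rV[R]_N) :
  (forall i, 0 <= lam i) -> \sum_i lam i = 1 ->
  dot (\sum_i lam i *: u i) (\sum_i lam i *: u i)
    <= \sum_i lam i * dot (u i) (u i).
Proof.
move=> lam0 lam1; set m := \sum_i _ *: _; rewrite -subr_ge0.
have mE : dot m m = \sum_i lam i * dot m (u i).
  by rewrite {2}/m dot_sumr; apply: eq_bigr => i _; rewrite dotZr.
suff -> : \sum_i lam i * dot (u i) (u i) - dot m m
    = \sum_i lam i * dot (u i - m) (u i - m).
  by apply: sumr_ge0 => i _; rewrite mulr_ge0 ?dot_ge0.
transitivity (\sum_i (lam i * dot (u i) (u i) - 2 * (lam i * dot m (u i))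
    + lam i * dot m m)).
  by rewrite big_split sumrB /= -mulr_sumr -mulr_suml -mE lam1; ring.
by apply: eq_bigr => i _; rewrite !dotE (dotC m); ring.
Qed.

End Dot.

Lemma dist2E (R : realType) (N : nat) (x y : 'rV[R]_N) :
  dist2 x y = dot x x - 2 * dot x y + dot y y.
Proof.
rewrite mulr_sumr -sumrB -big_split; apply: eq_bigr => i _ /=; ring.
Qed.

(** * Orthogonal projection along a span *)

Section Projection.
Context {R : realFieldType} {N : nat} {I : eqType} (w : I -> 'rV[R]_N).
Implicit Types (x y : 'rV[R]_N) (s : seq I) (a : I).

(* Gram-Schmidt: the orthogonal projection along the span of [w a], [a] in [s].
   When [w a] already lies in the span of the others, [b = 0] and the
   correction term vanishes. *)
Fixpoint oproj s x : 'rV[R]_N :=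
  if s is a :: s' then
    let b := oproj s' (w a) in oproj s' x - (dot x b / dot b b) *: b
  else x.

Lemma projD s x y : oproj s (x + y) = oproj s x + oproj s y.
Proof.
by elim: s => //= a s IH; rewrite IH dotDl mulrDl scalerDl opprD addrACA.
Qed.

Lemma projZ s k x : oproj s (k *: x) = k *: oproj s x.
Proof. by elim: s => //= a s IH; rewrite IH dotZl scalerBr scalerA mulrA. Qed.

Lemma projN s x : oproj s (- x) = - oproj s x.
Proof. by rewrite -scaleN1r projZ scaleN1r. Qed.

Lemma proj_sum (J : finType) s (f : J -> 'rV[R]_N) :
  oproj s (\sum_j f j) = \sum_j oproj s (f j).
Proof.
apply: (big_morph (oproj s)) => [x y|]; first exact: projD.
by have := projZ s 0 0; rewrite !scale0r.
Qed.

Lemma dot_proj s x y : dot (oproj s x) y = dot x (oproj s y).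
Proof.
elim: s => //= a s IH; rewrite !dotE IH; congr (_ - _).
by rewrite (dotC _ y); ring.
Qed.

Lemma proj_idem s x : oproj s (oproj s x) = oproj s x.
Proof.
elim: s x => //= a s IH x; set b := oproj s (w a).
have bb : oproj s b = b by rewrite IH.
rewrite projD projN projZ IH bb.
have -> : dot (oproj s x - (dot x b / dot b b) *: b) b = 0; last first.
  by rewrite mul0r scale0r subr0.
rewrite !dotE dot_proj bb; have [->|b0] := eqVneq b 0.
  by rewrite dotC !dot0l mulr0 subr0.
by rewrite divfK ?dot_eq0 // subrr.
Qed.

Lemma proj_mem s a : a \in s -> oproj s (w a) = 0.
Proof.
elim: s => //= c s IH; rewrite inE => /predU1P[->|/IH pa0].
  set b := oproj s (w c); have [->|b0] := eqVneq b 0.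
    by rewrite scaler0 subr0.
  have -> : dot (w c) b = dot b b by rewrite {2}/b dot_proj proj_idem.
  by rewrite divff ?dot_eq0 // scale1r subrr.
by rewrite pa0 -(proj_idem s (w c)) -dot_proj pa0 dot0l mul0r scale0r subr0.
Qed.

Lemma dot_proj_proj s x y : dot (oproj s x) (oproj s y) = dot (oproj s x) y.
Proof. by rewrite -dot_proj proj_idem. Qed.

Lemma dot_proj_residual s x :
  dot (x - oproj s x) (x - oproj s x) = dot x x - dot (oproj s x) (oproj s x).
Proof. by rewrite !dotE (dotC x) !dot_proj_proj; ring. Qed.

Lemma dot_proj_le s x : dot (oproj s x) (oproj s x) <= dot x x.
Proof. by rewrite -subr_ge0 -dot_proj_residual dot_ge0. Qed.

(** Pythagoras: passing from [s] to [a :: s] removes the component along [oproj s (w a)]. *)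
Lemma dot_proj_cons a s x : oproj s (w a) != 0 ->
  dot (oproj (a :: s) x) (oproj (a :: s) x) = dot (oproj s x) (oproj s x)
    - dot (oproj s x) (w a) ^+ 2 / dot (oproj s (w a)) (oproj s (w a)).
Proof.
set b := oproj s (w a) => b0 /=; rewrite -/b.
have xb : dot x b = dot (oproj s x) (w a) by rewrite dot_proj.
have yb : dot (oproj s x) b = dot (oproj s x) (w a) by rewrite dot_proj_proj.
by rewrite !dotE (dotC b) yb xb; field; rewrite dot_eq0.
Qed.

End Projection.

(** * Estimate for one translation *)

(* [X], [Y], [b], [e] and [f] stand for the scalar products
   |x|^2, |proj x|^2, |proj a|^2, <x, a> and <x - proj x, a>. *)
Lemma step_bound (R : realFieldType) (c al K r d d' X Y b e f : R) :
  0 <= c -> 1 <= al -> 0 <= K -> 1 <= r -> 0 <= d ->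
  (2 + al + (K + 1) * (2 * c ^+ 2 + 2 * al + 7 * al ^+ 2)) * (d + r + 1) <= d' ->
  X <= r ^+ 2 -> e <= c -> f ^+ 2 <= (X - Y) * al ->
  (e - f) ^+ 2 <= X * al -> 0 < b -> b <= al -> b^-1 <= K ->
  Y <= r ^+ 2 - d -> Y - (e - f) ^+ 2 / b <= r ^+ 2 - d' ->
  Y + 2 * (e - f) + b <= r ^+ 2 - d.
Proof.
move=> c0 al1 K0 r1 d0 hd' hX he hf; set t := e - f => ht b0 bal bK hY hY'.
have [neg|pos] := leP (2 * t + b) 0; first by lra.
rewrite leNgt; apply/negP => big.
have t_le : t <= r * al.
  have [|/ltW t0] := leP t 0.
    by move=> t0; apply: le_trans t0 _; apply: mulr_ge0; lra.
  rewrite -(ler_pXn2r (n := 2)) // ?nnegrE ?mulr_ge0; try lra.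
  by nra.
(* [big] forces [Y > r ^+ 2 - d - 2 * t - b], so the squared residual [X - Y] is at most linear in
   [d] and [r]; this keeps [f] small. *)
have hu : X - Y <= d + 2 * r * al + al by lra.
have t2 : t ^+ 2 <= 2 * c ^+ 2 + 2 * al * (d + 2 * r * al + al) + al ^+ 2.
  have hf2 : f ^+ 2 <= al * (d + 2 * r * al + al) by nra.
  (* If [t >= 0], then [t <= c - f] because [e <= c]; if [t < 0], then [- t < b / 2] by [pos]. *)
  have [t0|t0] := leP 0 t.
    have : t ^+ 2 <= (c - f) ^+ 2.
      by rewrite ler_pXn2r // ?nnegrE /t; rewrite /t in t0; lra.
    by have := sqr_ge0 (c + f); nra.
  have : t ^+ 2 <= al ^+ 2 by rewrite -sqrrN ler_pXn2r // ?nnegrE; lra.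
  have : 0 <= c ^+ 2 by exact: sqr_ge0.
  have := sqr_ge0 f; lra.
have tb : t ^+ 2 / b <= K * t ^+ 2.
  by rewrite mulrC ler_wpM2r ?sqr_ge0.
have tt : 2 * t <= t ^+ 2 + 1 by have := sqr_ge0 (t - 1); nra.
have Kt : (K + 1) * t ^+ 2 <= (K + 1) * (2 * c ^+ 2 + 2 * al * (d + 2 * r * al + al) + al ^+ 2).
  by rewrite ler_wpM2l // addr_ge0.
have U : 2 * c ^+ 2 + 2 * al * (d + 2 * r * al + al) + al ^+ 2 <=
   (2 * c ^+ 2 + 2 * al + 7 * al ^+ 2) * (d + r + 1).
  have := sqr_ge0 c; have := sqr_ge0 al => h1 h2.
  have : 0 <= c ^+ 2 * (d + r) by apply: mulr_ge0; lra.
  have : 0 <= al * (r + 1) by apply: mulr_ge0; lra.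
  have : 0 <= al ^+ 2 * d by apply: mulr_ge0; lra.
  have : 0 <= al ^+ 2 * r by apply: mulr_ge0; lra.
  nra.
have KU : (K + 1) * (2 * c ^+ 2 + 2 * al * (d + 2 * r * al + al) + al ^+ 2) <=
   (K + 1) * ((2 * c ^+ 2 + 2 * al + 7 * al ^+ 2) * (d + r + 1)).
  by rewrite ler_wpM2l // addr_ge0.
(* Now [d' < d + 2 * t + b + t ^+ 2 / b <= d + 1 + al + (K + 1) * t ^+ 2], which contradicts the
   lower bound on [d']. *)
have : (2 + al) * (d + r + 1) >= d + 1 + al by nra.
lra.
Qed.

(** Duplicate-free sequences have length at most [#|I|], so there are finitely many; this makes
    constants uniform in [s]. *)
Lemma uniq_seq_bound (R : realFieldType) (I : finType) (f : seq I -> R) :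
  exists K, 0 <= K /\ forall s, uniq s -> f s <= K.
Proof.
exists (\sum_(n < #|I|.+1) \sum_(t : n.-tuple I) `|f t|); split.
  by apply: sumr_ge0 => n _; apply: sumr_ge0.
move=> s us.
have ss : (size s < #|I|.+1)%N by rewrite ltnS -(card_uniqP us) max_card.
rewrite (bigD1 (Ordinal ss)) //= (bigD1 (in_tuple s)) //= -!addrA.
apply: le_trans (ler_norm _) _; rewrite lerDl addr_ge0 //.
  by apply: sumr_ge0.
by apply: sumr_ge0 => n _; apply: sumr_ge0.
Qed.

(** * The family of truncated balls *)

Section InvariantBody.
Context {R : realFieldType} {N : nat} {I : finType} (w : I -> 'rV[R]_N).
Variable L : R.
Hypothesis L_ge1 : 1 <= L.

(** For [D k = defect k * (r + 1)] the recursion reads [D k.+1 = L * (D k + r + 1)], the growth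
    demanded by [step_bound]. *)
Fixpoint defect k : R := if k is k'.+1 then L * (defect k' + 1) else 0.

(* A ball of radius [r] truncated by cylinders around the spans of the [w a];
   the larger the span, the thinner the cylinder. *)
Definition body (r : R) : set 'rV[R]_N :=
  [set x | forall s, uniq s ->
     dot (oproj w s x) (oproj w s x) <= r ^+ 2 - defect (size s) * (r + 1)].

Lemma defect_ge0 k : 0 <= defect k.
Proof. have L1 := L_ge1; elim: k => //= k IH; apply: mulr_ge0; lra. Qed.

Lemma defect_le k m : (k <= m)%N -> defect k <= defect m.
Proof.
elim: m k => [|m IH] [|k] //; rewrite ?ltnS => km; first exact: defect_ge0.
by rewrite /= ler_wpM2l ?lerD2r ?IH //; have := L_ge1; lra.
Qed.

(** From this radius on all levels are at least 1: with [D = defect #|I|] and [r >= 1],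
    [r ^+ 2 - D * (r + 1) >= r * (r - 2 * D)]. *)
Definition body_radius : R := 2 * defect #|I| + 1.

Lemma body_level_ge (s : seq I) r m : uniq s -> 0 <= m -> body_radius + m <= r ->
  m + 1 <= r ^+ 2 - defect (size s) * (r + 1).
Proof.
move=> us m0 hr; have D0 := defect_ge0 #|I|; rewrite /body_radius in hr.
have : defect (size s) <= defect #|I|.
  by apply: defect_le; rewrite -(card_uniqP us) max_card.
have := defect_ge0 (size s) => d0 dD.
have h1 : defect (size s) * (r + 1) <= defect #|I| * (r + 1).
  by apply: ler_wpM2r => //; lra.
have h2 : r * (1 + m) <= r * (r - 2 * defect #|I|) by apply: ler_wpM2l; lra.
nra.
Qed.

Lemma body_contains r m x : dot x x <= m -> body_radius + m <= r -> body r x.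
Proof.
move=> xm hr s us; have m0 := le_trans (dot_ge0 x) xm.
have := body_level_ge us m0 hr.
by have := dot_proj_le w s x; lra.
Qed.

Lemma body_bound r x : body r x -> dot x x <= r ^+ 2.
Proof. by move=> /(_ [::] isT) /=; rewrite mul0r subr0. Qed.

Lemma body_convex_comb (J : finType) (lam : J -> R) (u : J -> 'rV[R]_N) r :
  (forall j, 0 <= lam j) -> \sum_j lam j = 1 -> (forall j, body r (u j)) ->
  body r (\sum_j lam j *: u j).
Proof.
move=> lam0 lam1 Qu s us; rewrite proj_sum.
under eq_bigr do rewrite projZ.
apply: le_trans (dot_Jensen _ lam0 lam1) _.
set lev := _ - _; rewrite -[lev]mul1r -[X in X * lev]lam1 mulr_suml.
by apply: ler_sum => j _; rewrite ler_wpM2l // Qu.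
Qed.

(** Levels are at least 1, so the factor [(1 + eta) ^+ 2] gains at least [2 * eta]; this pays for
    the drop of each level, at most [2 * r * (r - r')] before scaling. *)
Lemma body_shrink r r' eta x : body_radius <= r' -> r' <= r -> 0 <= eta ->
  r * (r - r') * (1 + eta) ^+ 2 <= eta -> body r ((1 + eta) *: x) -> body r' x.
Proof.
move=> r'_ge r'r eta0 small Qx s us; have := Qx s us.
rewrite projZ !dotE; set Y := dot _ _.
have lr : 1 <= r ^+ 2 - defect (size s) * (r + 1).
  by rewrite -[leLHS]add0r; apply: body_level_ge; rewrite ?addr0 //; lra.
set A := _ - _ in lr *; set A' := _ - _ => YA.
have D0 := defect_ge0 (size s); have D0' := defect_ge0 #|I|.
have AA' : A - A' <= 2 * (r * (r - r')).
  rewrite /A /A'; rewrite /body_radius in r'_ge.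
  have : 0 <= defect (size s) * (r - r') by rewrite mulr_ge0 // subr_ge0.
  have := sqr_ge0 (r - r'); nra.
have e0 : 0 < (1 + eta) ^+ 2 by rewrite exprn_gt0 // ltr_wpDr.
rewrite -(ler_pM2l e0).
have h1 : (1 + eta) ^+ 2 * (A - A') <= (1 + eta) ^+ 2 * (2 * (r * (r - r'))).
  by rewrite ler_pM2l.
have h2 : 0 <= eta * (A - 1) by rewrite mulr_ge0 // subr_ge0.
have h3 : 0 <= eta ^+ 2 * A by rewrite mulr_ge0 ?sqr_ge0 //; lra.
nra.
Qed.

End InvariantBody.

(* The boundedness of the perceptron iteration [x := x + w a] under
   [<x, w a> <= c]. If [w a] is not parallel to a cylinder already, the point
   can only leave it near the equator [<x, w a> = O(sqrt r)], where the next
   thinner cylinder takes over. *)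
Lemma body_step_exists (R : realFieldType) (N : nat) (I : finType)
    (w : I -> 'rV[R]_N) (c : R) : 0 <= c ->
  exists L, 1 <= L /\ forall r x a, 1 <= r -> dot x (w a) <= c ->
    body w L r x -> body w L r (x + w a).
Proof.
move=> c0.
pose al := 1 + \sum_a dot (w a) (w a).
have w0 a : 0 <= dot (w a) (w a) by exact: dot_ge0.
have al1 : 1 <= al by rewrite lerDl; apply: sumr_ge0.
have w_le a : dot (w a) (w a) <= al.
  by rewrite /al (bigD1 a) //= addrCA lerDl addr_ge0 //; apply: sumr_ge0.
pose nb s a := dot (oproj w s (w a)) (oproj w s (w a)).
have nb0 s a : 0 <= (nb s a)^-1 by rewrite invr_ge0 dot_ge0.
(* A vanishing projection is harmless here, as [0^-1 = 0]. *)
have [K [K0 sum_le]] := uniq_seq_bound (fun s => \sum_a (nb s a)^-1).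
have proj_ge s a : uniq s -> (nb s a)^-1 <= K.
  move=> /sum_le; apply: le_trans; rewrite (bigD1 a) //= lerDl.
  by apply: sumr_ge0.
pose L := 2 + al + (K + 1) * (2 * c ^+ 2 + 2 * al + 7 * al ^+ 2).
have L1 : 1 <= L.
  have := sqr_ge0 c; have := sqr_ge0 al => h1 h2.
  suff : 0 <= (K + 1) * (2 * c ^+ 2 + 2 * al + 7 * al ^+ 2) by rewrite /L; lra.
  by apply: mulr_ge0; lra.
exists L; split=> // r x a r1 xa Qx s us; rewrite projD.
have [->|b0] := eqVneq (oproj w s (w a)) 0; first by rewrite addr0 Qx.
(* Hence [a :: s] is duplicate-free and its constraint on [x] is available. *)
have as_ : a \notin s by apply: contra b0 => /proj_mem ->.
have uas : uniq (a :: s) by rewrite /= as_.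
set y := oproj w s x; set b := oproj w s (w a).
have yb : dot y b = dot x (w a) - dot (x - y) (w a).
  by rewrite /y /b dot_proj_proj !dotE; ring.
have -> : dot (y + b) (y + b)
    = dot y y + 2 * (dot x (w a) - dot (x - y) (w a)) + dot b b.
  by rewrite -yb !dotE (dotC b y); ring.
apply: (@step_bound _ c al K r _ (defect L (size s).+1 * (r + 1)) (dot x x)) => //.
- by apply: mulr_ge0; [exact: defect_ge0 L1 _|lra].
- have d0 := mulr_ge0 (defect_ge0 L1 (size s)) (_ : 0 <= r + 1).
  have -> : defect L (size s).+1 * (r + 1)
      = L * (defect L (size s) * (r + 1) + r + 1) by rewrite /=; ring.
  apply: ler_wpM2r => //.
  by have := d0 ltac:(lra); lra.
- exact: (body_bound Qx).
- apply: le_trans (dot_CauchySchwarz _ _) _.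
  by rewrite dot_proj_residual ler_wpM2l // subr_ge0 dot_proj_le.
- rewrite -yb dot_proj_proj dot_proj.
  apply: le_trans (dot_CauchySchwarz _ _) _; rewrite ler_wpM2l ?dot_ge0 //.
  by apply: le_trans (dot_proj_le _ _ _) (w_le a).
- by rewrite lt_def dot_eq0 b0 dot_ge0.
- by apply: le_trans (dot_proj_le _ _ _) (w_le a).
- exact: proj_ge.
- exact: Qx.
- rewrite -yb (dot_proj_proj w s x (w a)) -dot_proj_cons //; exact: (Qx (a :: s)).
Qed.

(** * Compactness and norm bounds *)

Lemma compact_interior_margin (R : realType) (V : normedModType R)
    (A P : set V) : compact A -> A `<=` interior P ->
  exists2 d : R, 0 < d & forall g z, A g -> `|z| < d -> P (g + z).
Proof.
move=> /compact_near_coveringP cA AP.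
have [] := cA R (0^'+) (fun e g => forall z, `|z| < e -> P (g + z)) _.
  move=> g /AP /nbhs_ballP[d /= d0 gP].
  (* Half of the radius is spent on moving [g], half on [z]. *)
  exists (ball g (d / 2), [set e | e < d / 2]) => /=.
    by split; [exact/nbhsx_ballx/divr_gt0|exact/nbhs_right_lt/divr_gt0].
  move=> [h e] /= [hg ed] z ze; apply: gP.
  move: hg; rewrite -!ball_normE /= opprD addrA => hg.
  apply: le_lt_trans (ler_normB _ _) _.
  by rewrite [d]splitr ltrD // (lt_trans ze ed).
move=> e /= e0 he; exists (e / 2); first exact: divr_gt0.
move=> g z Ag; apply: (he (e / 2)) => //=; last exact: divr_gt0.
by rewrite sub0r normrN gtr0_norm ?divr_gt0 // ltr_pdivrMr // ltr_pMr // ltr1n.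
Qed.

(** The norm of a matrix is the maximum norm, which the Euclidean norm dominates. *)
Lemma mx_norm_le_dot (R : realType) (N : nat) (x : 'rV[R]_N) (r : R) :
  0 <= r -> dot x x <= r ^+ 2 -> `|x| <= r.
Proof.
move=> r0 xr; have [->//|/mx_norm_neq0[[i j]]] := eqVneq `|x| 0.
rewrite (ord1 i) => /= nx; rewrite [leLHS]nx.
rewrite -(ler_pXn2r (n := 2)) // ?nnegrE // real_normK ?num_real //.
exact: le_trans (sqr_coord_le_dot x j) xr.
Qed.

Lemma compact_dot_bound (R : realType) (N : nat) (A : set 'rV[R]_N) :
  compact A -> exists2 m : R, 0 <= m & forall x, A x -> dot x x <= m.
Proof.
move=> /compact_bounded[B [Breal BA]].
pose b := `|B| + 1.
exists (\sum_(i < N) b ^+ 2); first by apply: sumr_ge0 => i _; rewrite sqr_ge0.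
move=> x Ax; apply: ler_sum => i _; rewrite -expr2 -real_normK ?num_real //.
rewrite ler_pXn2r // ?nnegrE ?addr_ge0 //.
have xb : `|x| <= b by apply: BA => //; rewrite (le_lt_trans (ler_norm B)) // ltrDl.
apply: le_trans xb; rewrite [leRHS]mx_normrE.
by rewrite (le_bigmax _ (fun ij => `|x ij.1 ij.2|) (ord0, i)).
Qed.

(** * Invariance and absorption *)

Section Dynamics.
Context {R : realType} {N M : nat} (v : 'I_M -> 'rV[R]_N).
Variables (sel : 'rV[R]_N -> 'I_M) (L : R).
Hypothesis Hsel : nearest_selection v sel.
Hypothesis L_ge1 : 1 <= L.

(** Indexing by all pairs of vertices lets one finite family serve every Voronoi cell. *)
Definition vdiff (a : 'I_M * 'I_M) : 'rV[R]_N := v a.1 - v a.2.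

Definition vnorm_sum : R := \sum_j dot (v j) (v j).

Hypothesis body_step : forall r x a, 1 <= r ->
  dot x (vdiff a) <= vnorm_sum -> body vdiff L r x ->
  body vdiff L r (x + vdiff a).

(** Comparing squared distances cancels [dot x x] and leaves half of [dot (v j) (v j) - dot (v (sel
    x)) (v (sel x))] as a bound. *)
Lemma nearest_dot_le x j : dot x (vdiff (j, sel x)) <= vnorm_sum.
Proof.
have := Hsel x j; rewrite !dist2E !dotE /= => h.
have vj : dot (v j) (v j) <= vnorm_sum.
  rewrite /vnorm_sum (bigD1 j) //= lerDl.
  by apply: sumr_ge0 => i _; exact: dot_ge0.
by have := dot_ge0 (v (sel x)); have := dot_ge0 (v j); lra.
Qed.

(** The image is a convex combination of the points [x + vdiff (j, sel x)], each in the body by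
    [body_step]. *)
Lemma body_phi r g x : 1 <= r -> polytope v g ->
  body vdiff L r x -> body vdiff L r (phi v sel g x).
Proof.
move=> r1 [lam [lam0 [lam1 ->]]] Qx.
have -> : phi v sel (\sum_j lam j *: v j) x
    = \sum_j lam j *: (x + vdiff (j, sel x)).
  under [RHS]eq_bigr do rewrite addrCA scalerDr.
  by rewrite big_split /= -scaler_suml lam1 scale1r /phi addrCA.
apply: body_convex_comb => // j.
by apply: body_step => //; exact: nearest_dot_le.
Qed.

Lemma body_radius_ge1 : 1 <= body_radius (I := ('I_M * 'I_M)%type) L.
Proof.
have := defect_ge0 L_ge1 #|{: 'I_M * 'I_M}|.
by rewrite /body_radius; lra.
Qed.

Lemma body_phi_shrink r r' rX d eta g x :
  body_radius (I := ('I_M * 'I_M)%type) L <= r' -> r' <= r -> r <= rX ->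
  0 <= eta -> eta * rX < d -> rX * (r - r') * (1 + eta) ^+ 2 <= eta ->
  (forall z, `|z| < d -> polytope v (g + z)) ->
  body vdiff L r x -> body vdiff L r' (phi v sel g x).
Proof.
move=> r'_ge r'r rrX eta0 etad small gP Qx; have r0_ge1 := body_radius_ge1.
have r1 : 1 <= r by lra.
have d0 : 0 < d by apply: le_lt_trans etad; apply: mulr_ge0; lra.
have Pg : polytope v g by rewrite -[g]addr0; apply: gP; rewrite normr0.
have yr : `|phi v sel g x| <= r.
  by apply: mx_norm_le_dot; [lra|exact: body_bound (body_phi r1 Pg Qx)].
apply: (body_shrink L_ge1 (r := r) (eta := eta)) => //.
  apply: le_trans small; apply: ler_wpM2r; first exact: sqr_ge0.
  by apply: ler_wpM2r => //; lra.
(* Dilating the image amounts to moving [g] by less than [d], so the dilated image still lies in the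
   body of radius [r]. *)
have -> : (1 + eta) *: phi v sel g x = phi v sel (g + eta *: phi v sel g x) x.
  by rewrite scalerDl scale1r {1 3}/phi -!addrA; do 2! congr (_ + _); rewrite addrC.
apply: body_phi => //; apply: gP; rewrite normrZ ger0_norm //.
by apply: le_lt_trans etad; apply: ler_wpM2l => //; lra.
Qed.

Lemma body_absorbing (P0 X : set 'rV[R]_N) (r0 : R) :
  body_radius (I := ('I_M * 'I_M)%type) L <= r0 ->
  compact P0 -> P0 `<=` interior (polytope v) -> compact X ->
  exists n0 : nat, forall gs : seq 'rV[R]_N, (n0 < size gs)%N ->
    (forall g, g \in gs -> P0 g) ->
    forall x, X x -> body vdiff L r0 (phi_comp v sel gs x).
Proof.
move=> r0_ge cP0 P0P /compact_dot_bound[m m0 Xm].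
have [d d0 P0d] := compact_interior_margin cP0 P0P.
have r0_ge1 := le_trans body_radius_ge1 r0_ge.
pose rX := r0 + m; have rX1 : 1 <= rX by rewrite /rX; lra.
have rX0 : 0 < rX by lra.
pose eta := d / (2 * rX).
have eta0 : 0 < eta by rewrite divr_gt0 // mulr_gt0.
have etad : eta * rX < d.
  have -> : eta * rX = d / 2 by rewrite /eta; field; lra.
  by lra.
have sq0 : 0 < (1 + eta) ^+ 2 by rewrite exprn_gt0 //; lra.
(* The largest drop of radius that [body_phi_shrink] permits for this [eta] and [rX]. *)
pose eps := eta / (rX * (1 + eta) ^+ 2).
have eps0 : 0 < eps by rewrite divr_gt0 // mulr_gt0.
have epsE : rX * eps * (1 + eta) ^+ 2 = eta.
  by rewrite /eps; field; apply/andP; split; lra.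
(* The radius starts at [rX], large enough for [X], and falls by at most [eps] per map until it
   stops at [r0]. *)
pose rad n := Num.max r0 (rX - n%:R * eps).
have XQ gs x : (forall g, g \in gs -> P0 g) -> X x ->
    body vdiff L (rad (size gs)) (phi_comp v sel gs x).
  elim: gs => [|g gs IH] gP Xx /=.
    by apply: (body_contains _ L_ge1 (Xm _ Xx)); rewrite /rad le_max /rX; lra.
  have Qy := IH (fun h hh => gP h (mem_behead (s := g :: gs) hh)) Xx.
  have radS : rad (size gs) - eps <= rad (size gs).+1 <= rad (size gs).
    rewrite /rad -natr1; set n : R := (size gs)%:R.
    case: (leP r0 (rX - n * eps)) => h1;
      case: (leP r0 (rX - (n + 1) * eps)) => h2; apply/andP; split; lra.
  have /andP[radS1 radS2] := radS.
  apply: (body_phi_shrink (rX := rX) (d := d) (eta := eta)) Qy => //.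
  - by apply: le_trans r0_ge _; rewrite /rad le_max lexx.
  - have : 0 <= (size gs)%:R * eps by rewrite mulr_ge0 // ltW.
    by rewrite /rad ge_max /rX; lra.
  - exact: ltW.
  - rewrite -[leRHS]epsE; apply: ler_wpM2r; first exact: ltW.
    by apply: ler_wpM2l; lra.
  - by move=> z; apply: P0d; apply: gP; rewrite mem_head.
(* Past this index [rX - n%:R * eps] is negative, so the maximum is [r0]. *)
exists (Num.bound (rX / eps)) => gs n0 gP x Xx.
have -> : r0 = rad (size gs); last exact: XQ.
rewrite /rad; apply/esym/max_idPl.
have h : rX / eps < (size gs)%:R.
  apply: lt_trans (archi_boundP _) _; first by rewrite divr_ge0 // ltW.
  by rewrite ltr_nat.
by move: h; rewrite ltr_pdivrMr //; lra.
Qed.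

End Dynamics.

Unset Implicit Arguments.

Theorem theorem6p1 (R : realType) (N M : nat) (v : 'I_M -> 'rV[R]_N)
  (v_inj : injective v)
  (v_vert : forall i, extreme_point (polytope v) (v i))
  (sel : 'rV[R]_N -> 'I_M) (Hsel : nearest_selection v sel)
  (K : set 'rV[R]_N) (hK : compact K) :
  exists Q : set 'rV[R]_N,
    [/\ bounded_set Q, convex_set_rV Q, K `<=` Q,
        (forall g x, polytope v g -> Q x -> Q (phi v sel g x)) &
        (forall (P0 X : set 'rV[R]_N),
            compact P0 -> P0 `<=` interior (polytope v) -> compact X ->
            exists n0 : nat, forall gs : seq 'rV[R]_N,
              (n0 < size gs)%N -> (forall g, g \in gs -> P0 g) ->
              forall x, X x -> Q (phi_comp v sel gs x))].
Proof.
have c0 : 0 <= vnorm_sum v by apply: sumr_ge0 => j _; exact: dot_ge0.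
have [L [L1 step]] := body_step_exists (vdiff v) c0.
have [m m0 Km] := compact_dot_bound hK.
have rad1 : 1 <= body_radius (I := ('I_M * 'I_M)%type) L := body_radius_ge1 L1.
pose r0 := body_radius (I := ('I_M * 'I_M)%type) L + m.
have r01 : 1 <= r0 by rewrite (le_trans rad1) // lerDl.
exists (body (vdiff v) L r0); split.
- exists r0; split; first exact: num_real.
  move=> B r0B x Qx; apply: le_trans (ltW r0B).
  by apply: mx_norm_le_dot; [exact: le_trans r01|exact: body_bound Qx].
- move=> x y t Qx Qy /andP[t0 t1].
  (* A segment is a convex combination indexed by [bool]. *)
  have := @body_convex_comb _ _ _ (vdiff v) L bool
    (fun b => if b then t else 1 - t) (fun b => if b then y else x) r0.
  rewrite !big_bool /= (addrC (t *: y)); apply=> [[]||[]] //.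
    by rewrite subr_ge0.
  by rewrite addrC subrK.
- by move=> x /Km xm; exact: (body_contains _ L1 xm).
- by move=> g x; exact: body_phi.
- by move=> P0 X; apply: body_absorbing => //; rewrite lerDl.
Qed.
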